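(* Let $\alpha$ be an arbitrary ordinal number. Then there is an almost Dedekind domain $D$ of SP-rank $\alpha$.
   Context: An integral domain $D$ is an almost Dedekind domain if the localization $D_M$ is a discrete valuation ring for every maximal ideal $M$ of $D$. Let $\mathrm{Max}(D)$ be the set of maximal ideals of $D$ and $K$ the quotient field of $D$. A maximal ideal $M$ of an almost Dedekind domain $D$ is critical if every finitely generated ideal $I\subseteq M$ is contained in the square of some maximal ideal of $D$. Let $\mathrm{Crit}(D)$ be the set of critical maximal ideals of $D$. Define recursively, for ordinals $\alpha$, subsets $\mathrm{Crit}^\alpha(D)\subseteq\mathrm{Max}(D)$ and overrings $T_\alpha$ of $D$ (inside $K$): - $T_0:=D$ and $\mathrm{Crit}^0(D):=\mathrm{Max}(D)$; - if $\alpha=\beta+1$, then $\mathrm{Crit}^\alpha(D):=\{P\in\mathrm{Max}(D)\mid PT_\beta\in\mathrm{Crit}(T_\beta)\}$; - if $\alpha$ is a limit ordinal, then $\mathrm{Crit}^\alpha(D):=\bigcap_{\beta<\alpha}\mathrm{Crit}^\beta(D)$; - $T_\alpha:=\bigcap\{D_M\mid M\in\mathrm{Crit}^\alpha(D)\}$ (the empty intersection being $K$). The SP-rank of $D$ is the smallest ordinal $\alpha$ such that $\mathrm{Crit}^\alpha(D)=\emptyset$ (such an ordinal always exists).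
   Formalization: The ordinal α is assumed to be nonzero: since Crit^0(D) = Max(D) is nonempty for every integral domain D, no domain has SP-rank 0, so the claim fails for α = 0. *)

(* Defs.v *)
From mathcomp Require Import all_boot all_order all_algebra.
From mathcomp Require Import all_classical.
Set Implicit Arguments.
Unset Strict Implicit.
Unset Printing Implicit Defensive.
Import Order.TTheory GRing.Theory.
Local Open Scope classical_set_scope.
Local Open Scope ring_scope.

(* An integral domain is represented as a subring of its quotient field K, so
   that its overrings and localizations are again subsets of K. *)
Section Rings.
Variable K : fieldType.
Implicit Types (R V D : set K) (I J M N P X : set K) (C : set (set K)).

Definition domain_with_quotient_field D : Prop :=
  GRing.subring_closed [in D] /\
  forall x : K, exists a b, [/\ D a, D b, b != 0 & x = a / b].

Definition is_ideal R I : Prop :=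
  [/\ I `<=` R, I 0, forall x y, I x -> I y -> I (x + y)
    & forall r x, R r -> I x -> I (r * x)].

(* Meaningful for X `<=` R. *)
Definition ideal_gen R X : set K := smallest (is_ideal R) X.

Definition fg_ideal R I : Prop :=
  exists X, [/\ finite_set X, X `<=` R & I = ideal_gen R X].

Definition ideal_mul R I J : set K :=
  ideal_gen R [set z | exists x y, [/\ I x, J y & z = x * y]].

Definition is_maximal R M : Prop :=
  [/\ is_ideal R M, M <> R
    & forall J, is_ideal R J -> M `<=` J -> J = M \/ J = R].

Definition Max R : set (set K) := [set M | is_maximal R M].

(* The localization R_M at a prime ideal M. *)
Definition loc R M : set K :=
  [set x | exists a s, [/\ R a, R s, ~ M s & x = a / s]].

(* A discrete valuation ring: a local principal ideal domain, not a field. *)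
Definition dvr V : Prop :=
  [/\ GRing.subring_closed [in V],
      exists! M, is_maximal V M,
      forall I, is_ideal V I -> exists x, V x /\ I = ideal_gen V [set x]
    & exists x, [/\ V x, x != 0 & ~ V x^-1]].

Definition almost_dedekind D : Prop :=
  domain_with_quotient_field D /\ forall M, Max D M -> dvr (loc D M).

Definition Crit R : set (set K) :=
  [set M | Max R M /\
    forall I, fg_ideal R I -> I `<=` M ->
      exists N, Max R N /\ I `<=` ideal_mul R N N].

(* For C empty, this is the whole field K. *)
Definition loc_meet D C : set K := \bigcap_(M in C) loc D M.

End Rings.

(* Every ordinal is the order type of { b | b < a } for some element a of some
   well-ordered type A (for instance the last element of A = alpha + 1), the
   smaller ordinals being those represented by the b < a. *)
Section Hierarchy.
Variables (d : Order.disp_t) (A : orderType d).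
Hypothesis wf : well_founded (fun b a : A => (b < a)%O).
Implicit Types a b c : A.

Definition is_zero a : Prop := forall b, (a <= b)%O.

Definition succ_of b a : Prop := (b < a)%O /\ forall c, (c < a)%O -> (c <= b)%O.

Definition is_limit a : Prop := ~ is_zero a /\ ~ exists b, succ_of b a.

Variables (K : fieldType) (D : set K).

(* The ring T_b, given C = Crit^b(D). *)
Definition overring_of b (C : set (set K)) : set K :=
  if `[< is_zero b >] then D else loc_meet D C.

(* One clause for the three cases of the recursion, which are separated in
   Crit_zero, Crit_succ and Crit_limit below. *)
Definition Crit_step a (rec : forall b, (b < a)%O -> set (set K)) :
    set (set K) :=
  [set P | Max D P /\ forall b (ba : (b < a)%O),
    (succ_of b a ->
       Crit (overring_of b (rec b ba))
            (ideal_gen (overring_of b (rec b ba)) P)) /\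
    ((~ exists c, succ_of c a) -> rec b ba P)].

Definition Crit_iter : A -> set (set K) :=
  Fix wf (fun _ => set (set K)) Crit_step.

Definition overring a : set K := overring_of a (Crit_iter a).

Lemma Crit_iterE a : Crit_iter a = @Crit_step a (fun b _ => Crit_iter b).
Proof.
rewrite /Crit_iter Fix_eq// => x f g fg.
suff -> : f = g by [].
by apply: functional_extensionality_dep => y; apply: funext => p; exact: fg.
Qed.

Lemma Crit_zero a : is_zero a -> Crit_iter a = Max D.
Proof.
move=> a0; rewrite Crit_iterE; apply/seteqP; split=> P /=; first by case.
by move=> MP; split=> // b; rewrite ltNge a0.
Qed.

Lemma Crit_succ b a : succ_of b a ->
  Crit_iter a =
  [set P | Max D P /\ Crit (overring b) (ideal_gen (overring b) P)].
Proof.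
move=> ba; rewrite Crit_iterE; apply/seteqP; split=> P /=.
  by case=> MP /(_ b ba.1)[/(_ ba)].
case=> MP CP; split=> // c ca; split=> [sc|[]]; last by exists b.
suff -> : c = b by [].
by apply: le_anti; rewrite ba.2// sc.2// ba.1.
Qed.

Lemma Crit_limit a : is_limit a ->
  Crit_iter a = \bigcap_(b in [set b | (b < a)%O]) Crit_iter b.
Proof.
move=> [a0 aS]; rewrite Crit_iterE; apply/seteqP; split=> P /=.
  by case=> MP CP b ba; exact: (CP b ba).2.
move=> CP; split=> [|b ba]; last by split=> [sb|_]; [case: aS; exists b|exact: CP].
have [b ba] : exists b, (b < a)%O.
  apply: contrapT => nb; apply: a0 => b; rewrite leNgt; apply/negP => ba.
  by apply: nb; exists b.
by have := CP b ba; rewrite Crit_iterE => -[].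
Qed.

Lemma overring_zero a : is_zero a -> overring a = D.
Proof. by move=> a0; rewrite /overring /overring_of asboolT. Qed.

Lemma overring_pos a : ~ is_zero a -> overring a = loc_meet D (Crit_iter a).
Proof. by move=> a0; rewrite /overring /overring_of asboolF. Qed.

Definition is_SP_rank a : Prop :=
  Crit_iter a = set0 /\ forall b, Crit_iter b = set0 -> (a <= b)%O.

End Hierarchy.

(* Since every domain has a maximal ideal, Crit^0(D) = Max(D) is never empty
   and no domain has SP-rank 0. *)
Section Rank0.
Variables (K : fieldType) (D : set K).
Hypothesis subD : GRing.subring_closed [in D].

Lemma Max_neq0 : Max D <> set0.
Proof.
have [/set_mem D1 DB DM] := subD.
have D0 : D 0 by have := DB _ _ (mem_set D1) (mem_set D1); rewrite subrr inE.
pose Q X := is_ideal D (X `|` [set 0]) /\ ~ X 1.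
have [F FQ Ftot|M [[Mid M1] Mmax]] := @Zorn_bigcup K Q.
  split; last by case=> X /FQ[_ nX1] /nX1.
  split=> [x [[X /FQ[[XD _ _ _] _] Xx]|->//]||x y|r x Dr].
  - by apply: XD; left.
  - by right.
  - move=> [[X FX Xx]|->]; last by rewrite add0r.
    move=> [[Y FY Yy]|->]; last by rewrite addr0; left; exists X.
    have [Z FZ [Zx Zy]] : exists2 Z, F Z & Z x /\ Z y.
      have [XY|YX] := Ftot _ _ FX FY.
        by exists Y => //; split => //; exact: XY.
      by exists X => //; split => //; exact: YX.
    have [[_ _ ZD _] _] := FQ _ FZ.
    have [Zxy|->] := ZD x y (or_introl Zx) (or_introl Zy); last by right.
    by left; exists Z.
  - move=> [[X FX Xx]|->]; last by rewrite mulr0; right.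
    have [[_ _ _ XM] _] := FQ _ FX.
    have [Xrx|->] := XM r x Dr (or_introl Xx); last by right.
    by left; exists X.
apply/eqP/set0P; exists (M `|` [set 0]); split=> //.
  move=> MD; have : (M `|` [set 0]) 1 by rewrite MD.
  by case=> // /eqP; rewrite oner_eq0.
move=> J Jid MJ; have [JD J0 JA JM] := Jid.
have [J1|nJ1] := pselect (J 1).
  right; apply/seteqP; split=> // x Dx.
  by rewrite -[x]mulr1; exact: JM.
left; apply: contrapT => neq.
have J0E : J `|` [set 0] = J by apply/setUidl => _ ->.
apply: (Mmax J); last by split; rewrite ?J0E.
rewrite properEneq; split; last by move=> x Mx; apply: MJ; left.
by apply/eqP => MJE; apply: neq; rewrite MJE J0E.
Qed.

Lemma SP_rank_neq0 d (A : orderType d)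
    (wf : well_founded (fun b a : A => (b < a)%O)) (a : A) :
  is_SP_rank wf D a -> ~ is_zero a.
Proof. by move=> [Ca _] a0; apply: Max_neq0; rewrite -(Crit_zero wf D a0). Qed.

End Rank0.

(* Main.v *)
From HB Require Import structures.
Require Import Defs.
From mathcomp Require Import all_boot all_order all_algebra.
From mathcomp Require Import all_classical.
From mathcomp Require Import wochoice fraction finmap zify.
From mathcomp.multinomials Require Import monalg.
Set Implicit Arguments.
Unset Strict Implicit.
Unset Printing Implicit Defensive.
Import Order.TTheory GRing.Theory Num.Theory.
Local Open Scope classical_set_scope.
Local Open Scope ring_scope.

(** Write the divisors of a ring as integer-valued functions on its set of
maximal ideals.  In a Bezout almost Dedekind domain the divisors of nonzero
elements form a lattice-ordered group G of functions on a set X, and a point y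
is critical exactly when every g >= 0 in G with g y >= 1 takes a value >= 2
somewhere.  Passing to T_beta should amount to restricting the functions in G
to the points of Crit^beta.  The task is then to find a group G for which this
derivative takes alpha steps to exhaust X, and a domain with divisors G.

The points are the nonempty finite sequences of pairs (ordinal, integer) whose
ordinals are below alpha and strictly decrease from the root of the tree to
its leaves; a sequence is stored with the last pair in front, so that behead
is the parent map and the rank of a point is the ordinal in front.  The group
consists of the functions g such that g x = 2 g (parent x) for all but
finitely many x.  It is closed under subtraction and minimum because the
doubling condition is.  Among the points of rank >= beta, a point of rank
beta is a leaf, and its indicator function, which is <= 1, shows that it is
not critical; a point y of larger rank has infinitely many children of rank
beta, and one of them receives the value 2 g y, so that y is critical.  Hence
Crit^beta is the set of points of rank >= beta, which is empty exactly from
beta = alpha on.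

The domain comes from the theorem of Jaffard for groups of integer-valued
functions (realize_flgroup): in the monoid algebra of the nonnegative elements
of G, let v x f be the least value at x of the exponents occurring in f.  These
are valuations of the fraction field, and all divisors lie in G since G is
closed under minimum.  Two monomials X^a and X^b with a != b have a sum
whose divisor is min a b; as every element is associated to a monomial, this
gives the Bezout property (v_bezout).

What remains is that the domain has no maximal ideals except the obvious
ones, the centers of the valuations (maximal_sub_vmax).  Let an element f of a
maximal ideal M be a unit outside the subtree of y.  If M is not contained in
the center of y, the Bezout property makes f also a unit at y; then only
finitely many points, strictly below y, start a nonzero value of f, so f
divides a product of elements each supported on one of their subtrees.  M is
prime, so it contains one of these elements, whose subtree has a root of
smaller rank.  Well-foundedness ends the descent. *)

(** * Lattice-ordered groups of integer-valued functions *)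

Record flgroup (X : Type) := FLGroup {
  flcarrier :> (X -> int) -> Prop;
  fl0 : flcarrier (fun=> 0);
  flB : forall a b, flcarrier a -> flcarrier b ->
    flcarrier (fun x => a x - b x);
  flmin : forall a b, flcarrier a -> flcarrier b ->
    flcarrier (fun x => Num.min (a x) (b x)) }.

Section FlgroupTheory.
Variables (X : Type) (G : flgroup X).

Lemma flD a b : G a -> G b -> G (fun x => a x + b x).
Proof.
move=> Ga Gb; have := flB Ga (flB (fl0 G) Gb).
by congr (flcarrier G _); apply/funext => x; rewrite sub0r opprK.
Qed.

Lemma flN a : G a -> G (fun x => - a x).
Proof.
move=> Ga; have := flB (fl0 G) Ga.
by congr (flcarrier G _); apply/funext => x; rewrite sub0r.
Qed.

Lemma flmax a b : G a -> G b -> G (fun x => Num.max (a x) (b x)).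
Proof.
move=> Ga Gb; have := flN (flmin (flN Ga) (flN Gb)).
by congr (flcarrier G _); apply/funext => x; lia.
Qed.

Definition pospart (a : X -> int) x := Num.max (a x) 0.
Definition negpart (a : X -> int) x := Num.max (- a x) 0.

Lemma pospartB a x : pospart a x - negpart a x = a x.
Proof. rewrite /pospart /negpart; lia. Qed.

Lemma flpospart a : G a -> G (pospart a).
Proof. by move=> Ga; exact: flmax Ga (fl0 G). Qed.

Lemma flnegpart a : G a -> G (negpart a).
Proof. by move=> Ga; exact: flmax (flN Ga) (fl0 G). Qed.

End FlgroupTheory.

(** * A total order on functions refining evaluation at a point *)

Section LexOrder.
Variables (X : eqType) (x0 : X).

(** Any well-order becomes one starting at x0 when x0 is moved to the front.
Comparing functions at the first point where they differ then refines the
comparison of their values at x0. *)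
Lemma exists_wo_starting_at : exists D : X -> X -> Prop,
  [/\ forall A : set X, A !=set0 -> exists2 y, A y & forall z, D z y -> ~ A z,
      forall y z, y <> z -> D y z \/ D z y,
      forall x y z, D x y -> D y z -> D x z
    & forall y, ~ D y x0].
Proof.
have [R woR] := @well_ordering_principle X.
have two y z : R y z \/ R z y.
  have [|m [[] mA mlb _]] := woR [pred t | (t == y) || (t == z)].
    by exists y; rewrite inE eqxx.
  move: mA; rewrite inE => /orP[] /eqP mE; subst m.
    by left; apply: mlb; rewrite inE eqxx orbT.
  by right; apply: mlb; rewrite inE eqxx.
have Ra y z : R y z -> R z y -> y = z.
  move=> yz zy; have Ryy : R y y by case: (two y y).
  have Rzz : R z z by case: (two z z).
  have [|m [_ mu]] := woR [pred t | (t == y) || (t == z)].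
    by exists y; rewrite inE eqxx.
  have min_yz u : u = y \/ u = z -> m = u.
    move=> uE; apply: mu; split; first by case: uE => ->; rewrite inE eqxx ?orbT.
    by case: uE => -> t; rewrite inE => /orP[] /eqP ->.
  by rewrite -(min_yz y) ?(min_yz z) //; [right|left].
have Rt x y z : R x y -> R y z -> R x z.
  move=> xy yz.
  have [|m [[] mA mlb _]] := woR [pred t | [|| t == x, t == y | t == z]].
    by exists x; rewrite inE eqxx.
  move: mA; rewrite inE => /or3P[] /eqP mE; subst m.
  - by apply: mlb; rewrite inE eqxx !orbT.
  - have /(_ x) := mlb; rewrite inE eqxx => /(_ isT) yx.
    by rewrite (Ra _ _ xy yx).
  - have /(_ y) := mlb; rewrite inE eqxx orbT => /(_ isT) zy.
    by rewrite -(Ra _ _ yz zy).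
exists (fun z y => y <> x0 /\ (z = x0 \/ R z y /\ z <> y)).
split=> [A [a Aa]|y z yz|x y z [ny xy] [nz yz]|y []//].
- have [Ax0|nAx0] := pselect (A x0); first by exists x0 => // z [].
  have [|m [[] mA mlb _]] := woR [pred t | `[<A t>]].
    by exists a; rewrite inE; apply/asboolP.
  exists m; first by move: mA; rewrite inE => /asboolP.
  move=> z [_ [->//|[zm nzm] Az]]; apply: nzm; apply: Ra => //.
  by apply: mlb; rewrite inE; apply/asboolP.
- have [yE|ny] := pselect (y = x0); first by left; split; [congruence|left].
  have [zE|nz] := pselect (z = x0); first by right; split; [congruence|left].
  case: (two y z) => h; [left|right]; split=> //; right; split=> //; congruence.
- split=> //; case: xy => [->|[xy nxy]]; first by left.
  case: yz => [//|[yz nyz]]; right; split; first exact: Rt yz.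
  by move=> xz; subst z; apply: nxy; apply: Ra.
Qed.

(** The sum of the lexicographic minima p of s and q of t is obtained in only
one way.  For the product of two elements of a monoid algebra this means that
the coefficient at p + q is a product of two nonzero coefficients; since the
order starts at x0, it also identifies the least value at x0 of the exponents
of the product. *)
Lemma unique_minimal_sum (s t : seq (X -> int)) : s <> [::] -> t <> [::] ->
  exists p q, [/\ p \in s, q \in t,
    forall p', p' \in s -> p x0 <= p' x0,
    forall q', q' \in t -> q x0 <= q' x0
  & forall p' q', p' \in s -> q' \in t ->
      (forall z, p' z + q' z = p z + q z) -> p' = p /\ q' = q].
Proof.
have [D [Dmin Dtot Dtr Dx0]] := exists_wo_starting_at.
pose lt (a b : X -> int) :=
  exists2 y, a y < b y & forall z, D z y -> a z = b z.
have ltt a b c : lt a b -> lt b c -> lt a c.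
  move=> [y aby aby'] [z bcz bcz'].
  have [yz|yz] := pselect (y = z).
    subst z; exists y; first exact: lt_trans bcz.
    by move=> w wy; rewrite aby' // bcz'.
  case: (Dtot _ _ yz) => h.
    exists y; first by rewrite -bcz'.
    by move=> w wy; rewrite aby' // bcz' //; apply: Dtr h.
  exists z; first by rewrite aby'.
  by move=> w wz; rewrite aby' ?bcz' //; apply: Dtr h.
have lttot a b : a <> b -> lt a b \/ lt b a.
  move=> ab; have [|y /eqP aby abz] := Dmin [set y | a y <> b y].
    apply: contrapT => nab; apply: ab; apply/funext => y.
    by apply: contrapT => aby; apply: nab; exists y.
  have {}abz z : D z y -> a z = b z by move=> /abz /contrapT.
  by move: aby; rewrite neq_lt => /orP[h|h]; [left|right]; exists y => // z /abz.
have lt_le a b : lt a b -> a x0 <= b x0.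
  move=> [y aby aby']; have [yx|yx] := pselect (y = x0).
    by subst y; apply: ltW.
  by case: (Dtot _ _ yx) => [/Dx0//|/aby' ->].
have ltD a b c d : lt a b -> (c = d \/ lt c d) ->
    lt (fun z => a z + c z) (fun z => b z + d z).
  have ltDr a' b' c' : lt a' b' ->
      lt (fun z => a' z + c' z) (fun z => b' z + c' z).
    move=> [y aby aby']; exists y; first by rewrite ltrD2r.
    by move=> z /aby' ->.
  move=> ab [<-|cd]; first exact: ltDr.
  apply: ltt (ltDr _ _ _ ab) _.
  have addC (f g : X -> int) : (fun z => f z + g z) = fun z => g z + f z.
    by apply/funext => z; exact: addrC.
  by rewrite (addC b c) (addC b d); exact: ltDr.
have ltxx a : ~ lt a a by move=> [y]; rewrite ltxx.
have minE (r : seq (X -> int)) : r <> [::] ->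
    exists2 p, p \in r & forall p', p' \in r -> p = p' \/ lt p p'.
  elim: r => [//|a r IH _]; have [->|r0] := pselect (r = [::]).
    by exists a; rewrite ?inE // => p'; rewrite inE => /eqP ->; left.
  have [p pr pmin] := IH r0.
  have [pa|pa] := pselect (p = a \/ lt p a).
    exists p; first by rewrite inE pr orbT.
    by move=> p'; rewrite inE => /orP[/eqP ->//|/pmin].
  have ap : lt a p.
    case: (lttot p a) => // h; last by case: pa; right.
    by apply: pa; left.
  exists a; first by rewrite inE eqxx.
  move=> p'; rewrite inE => /orP[/eqP ->//|/pmin]; first by left.
  by move=> [<-|]; right => //; apply: ltt ap _.
move=> /minE[p ps pmin] /minE[q qt qmin]; exists p, q; split=> //.
- by move=> p' /pmin[->|/lt_le].
- by move=> p' /qmin[->|/lt_le].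
- move=> p' q' /pmin p's /qmin q't pq.
  have pp' : p = p'.
    case: p's => // /ltD/(_ q't).
    rewrite (_ : (fun z => p' z + q' z) = fun z => p z + q z); last exact/funext.
    by move=> /ltxx.
  split=> //; apply/funext => z; have := pq z; rewrite pp'; exact: addrI.
Qed.

End LexOrder.


(** * The monoid algebra of the nonnegative elements *)

Section Monomials.
Variables (X : choiceType) (G : flgroup X).

Definition effective (a : X -> int) : bool := `[< G a /\ forall x, 0 <= a x >].

Definition monomial := {a : X -> int | effective a}.

HB.instance Definition _ := Choice.on monomial.

Implicit Types m n : monomial.

Lemma monomialG m : G (val m).
Proof. by have /asboolP[] := valP m. Qed.

Lemma monomial_ge0 m x : 0 <= val m x.
Proof. by have /asboolP[] := valP m. Qed.

Fact monomial1_subproof : effective (fun=> 0).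
Proof. by apply/asboolP; split=> //; exact: fl0. Qed.

Definition monomial1 : monomial := exist effective _ monomial1_subproof.

Fact monomialM_subproof m n : effective (fun x => val m x + val n x).
Proof.
apply/asboolP; split=> [|x]; first exact: flD (monomialG m) (monomialG n).
by rewrite addr_ge0 // monomial_ge0.
Qed.

Definition monomialM m n : monomial := exist effective _ (monomialM_subproof m n).

Lemma monomialP m n : val m =1 val n -> m = n.
Proof. by move=> mn; apply: val_inj; apply/funext. Qed.

Fact monomialMA : associative monomialM.
Proof. by move=> m n p; apply: monomialP => x /=; rewrite addrA. Qed.
Fact monomialMC : commutative monomialM.
Proof. by move=> m n; apply: monomialP => x /=; rewrite addrC. Qed.
Fact monomial1M : left_id monomial1 monomialM.
Proof. by move=> m; apply: monomialP => x /=; rewrite add0r. Qed.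
Fact monomialM1 : right_id monomial1 monomialM.
Proof. by move=> m; apply: monomialP => x /=; rewrite addr0. Qed.

Fact monomial_conical m n :
  monomialM m n = monomial1 -> m = monomial1 /\ n = monomial1.
Proof.
move=> mn1.
have mn0 x : val m x + val n x = 0 by have := congr1 (fun p => val p x) mn1.
by split; apply: monomialP => x /=; apply/eqP; have /eqP := mn0 x;
  rewrite paddr_eq0 ?monomial_ge0 // => /andP[].
Qed.

HB.instance Definition _ := Choice_isMonomialDef.Build monomial
  monomialMA monomial1M monomialM1 monomial_conical.
HB.instance Definition _ := MonomialDef_isConomialDef.Build monomial monomialMC.

End Monomials.

(** The index set is pointed because the absence of zero divisors is read off
the valuation at some point. *)
Section MonoidDomain.
Variables (X : pointedType) (G : flgroup X).

(** The coefficients may be taken in any field. *)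
Definition monoid_domain := {malg rat[monomial G]}.
HB.instance Definition _ := GRing.ComNzRing.on monoid_domain.

Implicit Types f g : monoid_domain.

Lemma malg_neq0P f : f != 0 -> enum_fset (msupp f) <> [::].
Proof.
move=> /eqP f0 s0; apply: f0; apply/malgP => m; rewrite mcoeff0.
by apply: mcoeff_outdom; rewrite -[m \in _]/(m \in enum_fset (msupp f)) s0.
Qed.

Lemma extremal_product f g x : f != 0 -> g != 0 ->
  exists p q : monomial G, [/\ p \in msupp f, q \in msupp g,
    forall p', p' \in msupp f -> val p x <= val p' x,
    forall q', q' \in msupp g -> val q x <= val q' x
  & (f * g)@_(mmul p q) != 0].
Proof.
move=> /malg_neq0P f0 /malg_neq0P g0.
have [||p [q [ps qs pmin qmin uniq_pq]]] := @unique_minimal_sum X x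
  (map val (enum_fset (msupp f))) (map val (enum_fset (msupp g))).
- by case: (enum_fset _) f0.
- by case: (enum_fset _) g0.
have /mapP[/= m mf pE] := ps; have /mapP[/= n ng qE] := qs; subst p q.
exists m, n; split=> // [p' p'f|q' q'g|].
- by apply: pmin; apply: map_f.
- by apply: qmin; apply: map_f.
rewrite mcoeffMl (big_fsetD1 m) //= (big_fsetD1 n) //= eqxx mulr1n.
rewrite big1_fset ?addr0; last first.
  move=> n' + _; rewrite in_fsetD1 => /andP[nn' n'g].
  case: eqP => // mnE; case/eqP: nn'; apply: val_inj => /=.
  have [||z|_ ->//] := uniq_pq (val m) (val n'); [exact: map_f..|].
  by have := congr1 (fun p => val p z) mnE.
rewrite big1_fset ?addr0; last first.
  move=> m' + _; rewrite in_fsetD1 => /andP[mm' m'f].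
  apply: big1_fset => n' n'g _.
  case: eqP => // mnE; case/eqP: mm'; apply: val_inj => /=.
  have [||z|->//] := uniq_pq (val m') (val n'); [exact: map_f..|].
  by have := congr1 (fun p => val p z) mnE.
by rewrite mulf_neq0 // mcoeff_neq0.
Qed.

Definition malg_unit : pred monoid_domain := fun f => `[< exists g, g * f = 1 >].

Definition malg_inv f : monoid_domain :=
  if pselect (exists g, g * f = 1) is left ex then projT1 (cid ex) else f.

Fact malg_mulVx : {in malg_unit, left_inverse 1 malg_inv *%R}.
Proof.
move=> f /asboolP uf.
by rewrite /malg_inv; case: pselect => // ex; case: cid.
Qed.

Fact malg_unitPl f g : g * f = 1 -> f \in malg_unit.
Proof. by move=> gf; apply/asboolP; exists g. Qed.

Fact malg_invr_out : {in [predC malg_unit], malg_inv =1 id}.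
Proof.
move=> f /asboolP uf.
by rewrite /malg_inv; case: pselect.
Qed.

HB.instance Definition _ := GRing.ComNzRing_hasMulInverse.Build monoid_domain
  malg_mulVx malg_unitPl malg_invr_out.

Fact monoid_domain_mulf_eq0 f g : f * g = 0 -> (f == 0) || (g == 0).
Proof.
move=> fg0; apply: contraT; rewrite negb_or => /andP[f0 g0].
have [p [q [_ _ _ _]]] := extremal_product point f0 g0.
by rewrite fg0 mcoeff0 eqxx.
Qed.

HB.instance Definition _ :=
  GRing.ComUnitRing_isIntegral.Build monoid_domain monoid_domain_mulf_eq0.

End MonoidDomain.


Lemma msuppU1D (M : choiceType) (k : nzRingType) (m n : M) : m <> n ->
  msupp (<< m >> + << n >> : {malg k[M]}) = [fset m; n]%fset.
Proof.
have supp1 p : msupp (<< p >> : {malg k[M]}) = [fset p]%fset.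
  by rewrite msuppU oner_eq0.
move=> mn; rewrite msuppD !supp1 //.
by apply/fdisjointP => p; rewrite !in_fset1 => /eqP ->; apply/eqP.
Qed.

Lemma fraction_rep (R : idomainType) (z : {fraction R}) : exists ab : R * R,
  ab.2 != 0 /\ z = FracField.tofrac ab.1 / FracField.tofrac ab.2.
Proof.
elim/quotW: z => r; exists (frac r); split; first exact: denom_ratioP.
have numden1 h := (numer_Ratio h (oner_neq0 R), denom_Ratio h (oner_neq0 R)).
have d0 := denom_ratioP r.
unlock FracField.tofrac; rewrite -[_^-1]FracField.pi_inv -[RHS]FracField.pi_mul.
rewrite /FracField.mulf /FracField.invf /=.
rewrite !numden1 (numer_Ratio _ d0) (denom_Ratio _ d0) mulr1 mul1r.
by rewrite Ratio_numden.
Qed.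

(** * Valuations on a fraction field *)

Section FractionValuation.
Variables (R : idomainType) (X : Type) (ord : X -> R -> int).
Notation K := {fraction R}.
Notation "f %:F" := (@FracField.tofrac R f) (format "f %:F").
Hypothesis ordM : forall x f g, f != 0 -> g != 0 ->
  ord x (f * g) = ord x f + ord x g.
Hypothesis ordD : forall x f g, f != 0 -> g != 0 -> f + g != 0 ->
  Num.min (ord x f) (ord x g) <= ord x (f + g).

Definition fval (x : X) (z : K) : int :=
  let ab := projT1 (cid (fraction_rep z)) in ord x ab.1 - ord x ab.2.

Lemma fval_frac x f g : f != 0 -> g != 0 ->
  fval x (f%:F / g%:F) = ord x f - ord x g.
Proof.
move=> f0 g0; rewrite /fval; case: cid => -[a b] /= [b0 fgab].
have : f%:F * b%:F = a%:F * g%:F.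
  by apply/eqP; rewrite -eqr_div ?tofrac_eq0 //; apply/eqP.
rewrite -!tofracM => /eqP; rewrite tofrac_eq => /eqP fbag.
have a0 : a != 0.
  have : f * b != 0 by rewrite mulf_neq0.
  by rewrite fbag mulf_eq0 negb_or => /andP[].
have := congr1 (fun h => ord x h) fbag.
rewrite !ordM // => h; lia.
Qed.

Lemma frac_neq0 (z : K) : z != 0 ->
  exists f g, [/\ f != 0, g != 0 & z = f%:F / g%:F].
Proof.
have [[f g] /= [g0 ->]] := fraction_rep z => z0; exists f, g; split=> //.
by apply: contra_neq z0 => ->; rewrite tofrac0 mul0r.
Qed.

Lemma fvalM x (y z : K) : y != 0 -> z != 0 ->
  fval x (y * z) = fval x y + fval x z.
Proof.
move=> /frac_neq0[a [b [a0 b0 ->]]] /frac_neq0[c [d [c0 d0 ->]]].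
rewrite mulf_div -!tofracM !fval_frac ?mulf_neq0 // !ordM //; lia.
Qed.

Lemma fvalD x (y z : K) : y != 0 -> z != 0 -> y + z != 0 ->
  Num.min (fval x y) (fval x z) <= fval x (y + z).
Proof.
move=> /frac_neq0[a [b [a0 b0 ->]]] /frac_neq0[c [d [c0 d0 ->]]].
rewrite addf_div ?tofrac_eq0 // -!tofracM -tofracD mulf_eq0 invr_eq0 negb_or.
rewrite !tofrac_eq0 => /andP[abcd bd].
rewrite !fval_frac //.
have := @ordD x (a * d) (c * b); rewrite !mulf_neq0 // => /(_ isT isT abcd).
rewrite !ordM //.
move: (ord x (a * d + c * b)) (ord x a) (ord x b) (ord x c) (ord x d).
by move=> oabcd oa ob oc od; lia.
Qed.

End FractionValuation.

(** * Realizing a group of functions as a group of divisors *)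

Section Order.
Variables (X : pointedType) (G : flgroup X).
Notation R := (monoid_domain G).
Notation K := {fraction R}.
Notation "f %:F" := (@FracField.tofrac R f) (format "f %:F").
Implicit Types (f g : R) (m n : monomial G).

Definition pointwise_min (s : seq (monomial G)) (a : X -> int) : Prop :=
  G a /\ forall x, (exists2 m, m \in s & a x = val m x) /\
                   forall m, m \in s -> a x <= val m x.

(** Closure of G under minimum enters here: the least exponents at the various
points, attained at different monomials, are the values of one element of G. *)
Lemma exists_pointwise_min (s : seq (monomial G)) : s <> [::] ->
  exists a, pointwise_min s a.
Proof.
elim: s => // m s IH _; have [->|/IH[a [Ga aP]]] := pselect (s = [::]).
  exists (val m); split=> [|x]; first exact: monomialG.
  by split=> [|n]; [exists m; rewrite ?inE|rewrite inE => /eqP ->].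
exists (fun x => Num.min (val m x) (a x)).
split=> [|x]; first by apply: flmin => //; exact: monomialG.
have [[n ns an] lea] := aP x; split=> [|p].
  have [_|_] := leP (val m x) (a x); first by exists m; rewrite ?inE ?eqxx.
  by exists n; rewrite ?inE ?ns ?orbT.
by rewrite inE ge_min => /orP[/eqP ->|/lea ->]; rewrite ?lexx ?orbT.
Qed.

Lemma exists_pointwise_min_malg f : exists a, f != 0 -> pointwise_min (msupp f) a.
Proof.
have [->|f0] := eqVneq f 0; first by exists (fun=> 0).
by have [a aP] := exists_pointwise_min (malg_neq0P f0); exists a.
Qed.

Definition order_of (x : X) f : int := projT1 (cid (exists_pointwise_min_malg f)) x.

Lemma order_ofP f : f != 0 -> pointwise_min (msupp f) (order_of^~ f).
Proof. by rewrite /order_of; case: cid. Qed.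

Lemma order_ofE f x m : f != 0 -> m \in msupp f ->
  (forall n, n \in msupp f -> val m x <= val n x) -> order_of x f = val m x.
Proof.
move=> /order_ofP[_ /(_ x)[[n ns oE] h]] ms mle.
by apply/eqP; rewrite eq_le h // oE mle.
Qed.

Lemma order_ofM x f g : f != 0 -> g != 0 ->
  order_of x (f * g) = order_of x f + order_of x g.
Proof.
move=> f0 g0; have [p [q [pf qg pmin qmin pq]]] := extremal_product x f0 g0.
rewrite (order_ofE f0 pf) // (order_ofE g0 qg) //.
rewrite (@order_ofE (f * g) x (mmul p q)) ?mulf_neq0 // -?mcoeff_neq0 //.
move=> n /msuppM_le[k1 [k2 [k1f k2g ->]]].
by rewrite [X in X <= _]/= [X in _ <= X]/= lerD ?pmin ?qmin.
Qed.

Lemma order_ofD x f g : f != 0 -> g != 0 -> f + g != 0 ->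
  Num.min (order_of x f) (order_of x g) <= order_of x (f + g).
Proof.
move=> /order_ofP[_ /(_ x)[_ lef]] /order_ofP[_ /(_ x)[_ leg]].
move=> /order_ofP[_ /(_ x)[[m mfg ->] _]].
rewrite ge_min; have := fsubsetP (msuppD_le f g) _ mfg.
by rewrite in_fsetU => /orP[/lef ->|/leg ->]; rewrite ?orbT.
Qed.

Definition mono m : R := << m >>.

Lemma mono_neq0 m : mono m != 0.
Proof. by rewrite monalgU_eq0 oner_eq0. Qed.

Lemma order_of_mono m x : order_of x (mono m) = val m x.
Proof.
have mm : m \in msupp (mono m) by rewrite msuppU1 in_fset1.
apply: (order_ofE (mono_neq0 m) mm) => n.
by rewrite msuppU1 in_fset1 => /eqP ->.
Qed.

Lemma monoD_supp m n : m <> n -> msupp (mono m + mono n) = [fset m; n]%fset.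
Proof. exact: msuppU1D. Qed.

Lemma monoD_neq0 m n : m <> n -> mono m + mono n != 0.
Proof.
move=> mn; apply/eqP => mn0; have := monoD_supp mn.
by rewrite mn0 msupp0 => /fsetP/(_ m); rewrite !inE eqxx.
Qed.

Lemma order_of_monoD m n x : m <> n ->
  order_of x (mono m + mono n) = Num.min (val m x) (val n x).
Proof.
move=> mn; have supp := monoD_supp mn.
have mD := monoD_neq0 mn.
have [le_mn|/ltW le_nm] := leP (val m x) (val n x).
  by apply: order_ofE => //; rewrite supp ?inE ?eqxx // => p;
    rewrite !inE => /orP[] /eqP ->.
by apply: order_ofE => //; rewrite supp ?inE ?eqxx ?orbT // => p;
  rewrite !inE => /orP[] /eqP ->.
Qed.

Notation fval := (fval order_of).

Lemma fvalG (z : K) : z != 0 -> G (fval^~ z).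
Proof.
move=> /frac_neq0[a [b [a0 b0 ->]]].
rewrite (_ : fval^~ _ = fun x => order_of x a - order_of x b); last first.
  by apply/funext => x; rewrite (fval_frac order_ofM).
by apply: flB; [case: (order_ofP a0)|case: (order_ofP b0)].
Qed.

(** Writing a - b with a common denominator cd turns X^a and X^b into quotients
of distinct monomials by the same monomial, and the exponents of a sum of two
distinct monomials are just these two: no cancellation can occur. *)
Lemma fval_sum_min (a b : X -> int) : G a -> G b -> a <> b ->
  exists y z : K, [/\ [/\ y != 0, z != 0 & y + z != 0], fval^~ y = a, fval^~ z = b
    & forall x, fval x (y + z) = Num.min (a x) (b x)].
Proof.
move=> Ga Gb ab.
have effP c : G c -> (forall x, 0 <= c x) -> {m : monomial G | val m = c}.
  move=> Gc c0; have cP : effective G c by apply/asboolP.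
  by exists (exist (effective G) c cP).
have neg_ge0 c x : 0 <= negpart c x by rewrite /negpart; lia.
pose ca x : int := pospart a x + negpart b x.
pose cb x : int := pospart b x + negpart a x.
pose cd x : int := negpart a x + negpart b x.
have caE x : ca x - cd x = a x by have := pospartB a x; rewrite /ca /cd; lia.
have cbE x : cb x - cd x = b x by have := pospartB b x; rewrite /cb /cd; lia.
have [||ma maE] := effP ca.
- exact: flD (flpospart Ga) (flnegpart Gb).
- by move=> x; rewrite /ca /pospart /negpart; lia.
have [||mb mbE] := effP cb.
- exact: flD (flpospart Gb) (flnegpart Ga).
- by move=> x; rewrite /cb /pospart /negpart; lia.
have [||md mdE] := effP cd.
- exact: flD (flnegpart Ga) (flnegpart Gb).
- by move=> x; rewrite /cd /pospart /negpart; lia.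
have mab : ma <> mb.
  move=> mab; apply: ab; apply/funext => x.
  by rewrite -caE -cbE -maE -mbE mab.
exists ((mono ma)%:F / (mono md)%:F), ((mono mb)%:F / (mono md)%:F).
have Fneq0 f : f != 0 -> f%:F != 0 by rewrite tofrac_eq0.
have F0 f : f != 0 -> f%:F / (mono md)%:F != 0.
  move=> f0; apply: mulf_neq0; first exact: Fneq0.
  by rewrite invr_eq0; exact: Fneq0 (mono_neq0 md).
have mab0 := monoD_neq0 mab.
have mdab : (mono ma)%:F / (mono md)%:F + (mono mb)%:F / (mono md)%:F
    = (mono ma + mono mb)%:F / (mono md)%:F by rewrite -mulrDl -tofracD.
rewrite mdab; split.
- by split; apply: F0 => //; exact: mono_neq0.
- by apply/funext => x; rewrite
    (fval_frac order_ofM _ (mono_neq0 ma) (mono_neq0 md)) !order_of_mono maE mdE.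
- by apply/funext => x; rewrite
    (fval_frac order_ofM _ (mono_neq0 mb) (mono_neq0 md)) !order_of_mono mbE mdE.
- move=> x; rewrite (fval_frac order_ofM _ mab0 (mono_neq0 md)).
  by rewrite order_of_monoD // order_of_mono maE mbE mdE -caE -cbE; lia.
Qed.

End Order.

(** The last clause is stronger than surjectivity of the divisor map onto G:
the two elements can be chosen so that their sum has the smallest possible
values, which is what makes the rings of integral elements Bezout. *)
Theorem realize_flgroup (X : pointedType) (G : flgroup X) :
  exists (K : fieldType) (v : X -> K -> int),
  [/\ forall x f g, f != 0 -> g != 0 -> v x (f * g) = v x f + v x g,
      forall x f g, f != 0 -> g != 0 -> f + g != 0 ->
        Num.min (v x f) (v x g) <= v x (f + g),
      forall f, f != 0 -> G (v^~ f)
    & forall a b : X -> int, G a -> G b -> a <> b ->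
        exists f g, [/\ [/\ f != 0, g != 0 & f + g != 0], v^~ f = a, v^~ g = b
          & forall x, v x (f + g) = Num.min (a x) (b x)]].
Proof.
exists {fraction monoid_domain G}, (fval (@order_of X G)); split.
- exact: fvalM (@order_ofM X G).
- exact: fvalD (@order_ofM X G) (@order_ofD X G).
- exact: fvalG.
- exact: fval_sum_min.
Qed.


(** * Ideals of a subring of a field *)

Section IdealGen.
Variables (K : fieldType) (R : set K).
Hypothesis subR : GRing.subring_closed [in R].

Lemma subring_prop : [/\ R 0, R 1, forall x y, R x -> R y -> R (x - y),
  forall x y, R x -> R y -> R (x + y) & forall x y, R x -> R y -> R (x * y)].
Proof.
have [/set_mem R1 RB RM] := subR.
have RB' x y : R x -> R y -> R (x - y).
  by move=> Rx Ry; apply/set_mem/RB; exact/mem_set.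
have R0 : R 0 by have := RB' _ _ R1 R1; rewrite subrr.
split=> // x y Rx Ry; last by apply/set_mem/RM; exact/mem_set.
by have := RB' _ _ Rx (RB' _ _ R0 Ry); rewrite sub0r opprK.
Qed.

Lemma ring_ideal : is_ideal R R.
Proof. by have [? ? ? ? ?] := subring_prop; split. Qed.

Lemma ideal_gen_sub I (Y : set K) : is_ideal R I -> Y `<=` I -> ideal_gen R Y `<=` I.
Proof. by move=> idI YI; exact: smallest_sub. Qed.

Lemma ideal_gen_subset (Y : set K) : Y `<=` ideal_gen R Y.
Proof. exact: sub_gen_smallest. Qed.

Lemma ideal_gen_ideal (Y : set K) : Y `<=` R -> is_ideal R (ideal_gen R Y).
Proof.
move=> YR; split=> [|I [[]]//|x y Ix Iy I II|r x Rr Ix I II].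
- exact: ideal_gen_sub ring_ideal YR.
- by have [[_ _ ID _] _] := II; apply: ID; [exact: Ix|exact: Iy].
- by have [[_ _ _ IM] _] := II; apply: IM => //; exact: Ix.
Qed.

Lemma ideal1 I : is_ideal R I -> I 1 -> I = R.
Proof.
move=> [IR _ _ IM] I1; apply/seteqP; split=> // x Rx.
by rewrite -[x]mulr1; exact: IM.
Qed.

Lemma principal_ideal x : R x -> ideal_gen R [set x] = [set r * x | r in R].
Proof.
have [R0 R1 _ RD RM] := subring_prop => Rx; apply/seteqP; split.
  apply: ideal_gen_sub => [|_ ->]; last by exists 1; rewrite // mul1r.
  split=> [_ [r Rr <-]||_ _ [r Rr <-] [s Rs <-]|t _ Rt [s Rs <-]].
  - exact: RM.
  - by exists 0; rewrite // mul0r.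
  - by exists (r + s); rewrite ?mulrDl //; exact: RD.
  - by exists (t * s); rewrite ?mulrA //; exact: RM.
move=> _ [r Rr <-].
have [|_ _ _] := @ideal_gen_ideal [set x]; first by move=> _ ->.
by apply=> //; exact: ideal_gen_subset.
Qed.

Lemma maximal_prime M x y : is_maximal R M -> R x -> R y -> M (x * y) ->
  M x \/ M y.
Proof.
have [R0 R1 _ RD RM] := subring_prop.
move=> [[MR M0 MD MM] MnR Mmax] Rx Ry Mxy.
have [Mx|nMx] := pselect (M x); [by left|right].
have [||JM|JR] := Mmax [set z | exists m r, [/\ M m, R r & z = m + r * x]].
- split=> [_ [m [r [Mm Rr ->]]]|
          |_ _ [m [r [Mm Rr ->]]] [n [s [Mn Rs ->]]]
          |t _ Rt [m [r [Mm Rr ->]]]].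
  + by apply: RD; [exact: MR|exact: RM].
  + by exists 0, 0; rewrite mul0r addr0.
  + exists (m + n), (r + s); rewrite mulrDl addrACA.
    by split; [exact: MD|exact: RD|].
  + exists (t * m), (t * r); rewrite mulrDr mulrA; split=> //; first exact: MM.
    exact: RM.
- by move=> m Mm; exists m, 0; rewrite mul0r addr0.
- by case: nMx; rewrite -JM; exists 0, 1; rewrite mul1r add0r.
have : [set z | exists m r, [/\ M m, R r & z = m + r * x]] 1 by rewrite JR.
move=> [m [r [Mm Rr e]]].
rewrite -[y]mul1r e mulrDl; apply: MD; first by rewrite mulrC; exact: MM.
by rewrite -mulrA; exact: MM.
Qed.

End IdealGen.

(** * Rings of elements integral on a set of points *)

Section ValuedField.
Variables (K : fieldType) (X : Type) (v : X -> K -> int) (G : flgroup X).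
Hypothesis vM : forall x f g, f != 0 -> g != 0 -> v x (f * g) = v x f + v x g.
Hypothesis vD : forall x f g, f != 0 -> g != 0 -> f + g != 0 ->
  Num.min (v x f) (v x g) <= v x (f + g).
Hypothesis vG : forall f, f != 0 -> G (v^~ f).
Hypothesis vmin : forall a b : X -> int, G a -> G b -> a <> b ->
  exists f g, [/\ [/\ f != 0, g != 0 & f + g != 0], v^~ f = a, v^~ g = b
    & forall x, v x (f + g) = Num.min (a x) (b x)].

Lemma v1 x : v x 1 = 0.
Proof.
by have := vM x (oner_neq0 K) (oner_neq0 K); rewrite mulr1; move: (v x 1) => n; lia.
Qed.

Lemma vV x f : f != 0 -> v x f^-1 = - v x f.
Proof.
move=> f0; have := @vM x f f^-1 f0; rewrite invr_eq0 f0 divff // v1 => /(_ isT).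
lia.
Qed.

Lemma vN x f : f != 0 -> v x (- f) = v x f.
Proof.
move=> f0; have N10 : (-1 : K) != 0 by rewrite oppr_eq0 oner_eq0.
have := @vM x (-1) (-1) N10 N10; rewrite mulrNN mulr1 v1 => vN1.
rewrite -mulN1r vM //; lia.
Qed.

Lemma v_surj a : G a -> exists2 f, f != 0 & forall x, v x f = a x.
Proof.
move=> Ga; have [->|a0] := pselect (a = fun=> 0).
  by exists 1; [exact: oner_neq0|exact: v1].
have [f [g [[f0 _ _] <- _ _]]] := vmin Ga (fl0 G) a0.
by exists f.
Qed.

(** Each of f and g is replaced by an associate whose divisor is the same;
the coefficients r and s are the two units, or 1 and 0 when the divisors
agree and f itself is a greatest common divisor. *)
Lemma v_bezout f g : f != 0 -> g != 0 -> exists r s,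
  [/\ forall x, r != 0 -> 0 <= v x r, forall x, s != 0 -> 0 <= v x s,
      r * f + s * g != 0
    & forall x, v x (r * f + s * g) = Num.min (v x f) (v x g)].
Proof.
move=> f0 g0; have [vfg|vfg] := pselect (v^~ f = v^~ g).
  exists 1, 0; split=> [x _|x||x]; rewrite ?v1 ?eqxx // mul1r mul0r addr0 //.
  by rewrite -[v x g]/((v^~ g) x) -vfg minxx.
have [f' [g' [[f'0 g'0 fg0] vf vg vfg']]] := vmin (vG f0) (vG g0) vfg.
have unit h h' x : h != 0 -> h' != 0 -> v^~ h' = v^~ h -> 0 <= v x (h' / h).
  move=> h0 h'0 hh; rewrite vM ?invr_eq0 // vV //.
  by rewrite -[v x h']/((v^~ h') x) hh subrr.
exists (f' / f), (g' / g); rewrite !divfK //; split=> // x _; exact: unit.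
Qed.

(** The implication gives 0 the value +oo: v y 0 is an arbitrary integer. *)
Definition vge y n : set K := [set f | f != 0 -> n <= v y f].

Lemma vge0 y n : vge y n 0. Proof. by rewrite /vge/= eqxx. Qed.

Lemma vgeW y m n f : m <= n -> vge y n f -> vge y m f.
Proof. by move=> mn nf f0; apply: le_trans (nf f0). Qed.

Lemma vgeD y n f g : vge y n f -> vge y n g -> vge y n (f + g).
Proof.
have [->|f0] := eqVneq f 0; first by rewrite add0r.
have [->|g0] := eqVneq g 0; first by rewrite addr0.
move=> /(_ f0) nf /(_ g0) ng fg0; apply: le_trans (vD _ f0 g0 fg0).
by rewrite le_min nf.
Qed.

Lemma vgeN y n f : vge y n f -> vge y n (- f).
Proof. by move=> nf; rewrite /vge/= oppr_eq0 => f0; rewrite vN //; exact: nf. Qed.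

Lemma vgeM y m n f g : vge y m f -> vge y n g -> vge y (m + n) (f * g).
Proof.
move=> mf ng; rewrite /vge/= mulf_eq0 negb_or => /andP[f0 g0].
by rewrite vM // lerD //; [exact: mf|exact: ng].
Qed.

Lemma vgeM0 y n f g : vge y 0 f -> vge y n g -> vge y n (f * g).
Proof. by move=> f0 g0; have := vgeM f0 g0; rewrite add0r. Qed.

Definition vring (C : set X) : set K := [set f | forall y, C y -> vge y 0 f].

(** The center of the valuation at y. *)
Definition vmax C y : set K := vring C `&` vge y 1.

Lemma vring_subring C : GRing.subring_closed [in vring C].
Proof.
split=> [|f g /set_mem Cf /set_mem Cg|f g /set_mem Cf /set_mem Cg];
  apply/mem_set => y Cy.
- by move=> _; rewrite v1.
- by apply: vgeD; [exact: Cf|apply: vgeN; exact: Cg].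
- by apply: vgeM0; [exact: Cf|exact: Cg].
Qed.

Lemma vring_prop C : [/\ vring C 0, vring C 1,
  forall x y, vring C x -> vring C y -> vring C (x - y),
  forall x y, vring C x -> vring C y -> vring C (x + y)
  & forall x y, vring C x -> vring C y -> vring C (x * y)].
Proof. exact/subring_prop/vring_subring. Qed.

Lemma vring_sub C C' : C' `<=` C -> vring C `<=` vring C'.
Proof. by move=> C'C f Cf y /C'C /Cf. Qed.

Lemma vge_ideal C y n : C y -> is_ideal (vring C) (vring C `&` vge y n).
Proof.
have [R0 _ _ RD RM] := vring_prop C.
move=> Cy; split=> [f []//||f g [Cf nf] [Cg ng]|r f Cr [Cf nf]].
- by split=> //; exact: vge0.
- by split; [exact: RD|exact: vgeD].
- by split; [exact: RM|apply: vgeM0 => //; exact: Cr].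
Qed.

Lemma vmax_ideal C y : C y -> is_ideal (vring C) (vmax C y).
Proof. exact: vge_ideal. Qed.

Lemma vmax_not1 C y : ~ vmax C y 1.
Proof. by move=> [_ /(_ (oner_neq0 K))]; rewrite v1. Qed.

(** An element f of the ring outside the center of y is a unit at y.  The
function b provided for the divisor of f vanishes at all points where f is not
a unit, so an element g with divisor b lies in the center of y and the
greatest common divisor of f and g is a unit. *)
Lemma vmax_maximal C y : C y ->
    (forall a, G a -> a y = 0 ->
      exists2 b, G b & [/\ forall z, 0 <= b z, b y = 1
                         & forall z, a z <> 0 -> b z = 0]) ->
  is_maximal (vring C) (vmax C y).
Proof.
move=> Cy mask; split; first exact: vmax_ideal.
  by have [_ R1 _ _ _] := vring_prop C => E; apply: (@vmax_not1 C y); rewrite E.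
move=> J idJ MJ; have [JR _ JD JM] := idJ.
have [JM'|] := pselect (J `<=` vmax C y); first by left; apply/seteqP.
move=> /existsNP[f /not_implyP[Jf nMf]]; right; apply: ideal1 => //.
have f0 : f != 0.
  by apply/eqP => fE; apply: nMf; have [_ M0 _ _] := vmax_ideal Cy; rewrite fE.
have Cf := JR _ Jf.
have vf0 : v y f = 0.
  apply/eqP; rewrite eq_le (Cf y Cy f0) andbT leNgt; apply/negP => fy.
  by apply: nMf; split=> // _; lia.
have [b Gb [b0 by1 ab]] := mask _ (vG f0) vf0.
have [g g0 gb] := v_surj Gb.
have Jg : J g by apply: MJ; split=> [z _ _|_]; rewrite gb // by1.
have [r [s [r0 s0 h0 vh]]] := v_bezout f0 g0.
set h := r * f + s * g in h0 vh.
have Jh : J h by apply: JD; apply: JM => // z _; [exact: r0|exact: s0].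
rewrite -(mulVf h0); apply: JM => // z Cz _; rewrite vV // vh gb.
have := Cf z Cz f0; have [->|] := eqVneq (v z f) 0.
  by rewrite min_l // b0.
by move=> /eqP /ab -> _; rewrite oppr_ge0 ge_min lexx orbT.
Qed.

(** s is a unit wherever f is integral, so multiplying by s clears the
poles of f without changing anything at the other points. *)
Lemma exists_denominator f : f != 0 -> exists s, [/\ s != 0,
  forall y, v y s = negpart (v^~ f) y & forall y, v y (f * s) = pospart (v^~ f) y].
Proof.
move=> f0; have [s s0 sE] := v_surj (flnegpart (vG f0)).
exists s; split=> // y; rewrite vM // sE.
by have := pospartB (v^~ f) y; lia.
Qed.

Lemma pospart_ge0 (a : X -> int) y : 0 <= pospart a y.
Proof. rewrite /pospart; lia. Qed.

Lemma negpart_ge0 (a : X -> int) y : 0 <= negpart a y.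
Proof. rewrite /negpart; lia. Qed.

Lemma loc_vmax C y : C y -> loc (vring C) (vmax C y) = vring [set y].
Proof.
have [R0 R1 _ _ _] := vring_prop C.
move=> Cy; apply/seteqP; split=> x.
  move=> [a [s [Ca Cs nMs ->]]] _ -> as0.
  move: (as0); rewrite mulf_eq0 invr_eq0 negb_or => /andP[a0 s0].
  rewrite vM ?invr_eq0 // vV //; have := Ca y Cy a0.
  suff : v y s < 1 by lia.
  by rewrite ltNge; apply/negP => s1; apply: nMs; split.
move=> yx; have [->|x0] := eqVneq x 0.
  by exists 0, 1; rewrite mul0r; split => //; exact: vmax_not1.
have [s [s0 vs vxs]] := exists_denominator x0.
exists (x * s), s; split.
- by move=> z _ _; rewrite vxs pospart_ge0.
- by move=> z _ _; rewrite vs negpart_ge0.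
- by move=> [_ /(_ s0)]; rewrite vs /negpart; have := yx y erefl x0; lia.
- by rewrite mulfK.
Qed.

Lemma vring_quotient_field C : domain_with_quotient_field (vring C).
Proof.
split=> [|x]; first exact: vring_subring.
have [R0 R1 _ _ _] := vring_prop C.
have [->|x0] := eqVneq x 0.
  by exists 0, 1; rewrite mul0r oner_eq0; split.
have [s [s0 vs vxs]] := exists_denominator x0.
exists (x * s), s; rewrite mulfK //; split=> // z _ _.
  by rewrite vxs pospart_ge0.
by rewrite vs negpart_ge0.
Qed.

(** An element of least value generates. *)
Lemma vring1_ideal y I : is_ideal (vring [set y]) I ->
  exists x, vring [set y] x /\ I = ideal_gen (vring [set y]) [set x].
Proof.
set V := vring [set y] => idI; have [IV I0 ID IM] := idI.
have subV := vring_subring [set y].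
have [R0 _ _ _ _] := vring_prop [set y].
have [I00|] := pselect (forall x, I x -> x = 0).
  exists 0; split=> //; rewrite principal_ideal //; apply/seteqP; split=> x.
    by move=> /I00 ->; exists 0; rewrite // mul0r.
  by move=> [r _ <-]; rewrite mulr0.
move=> /existsNP[x1 /not_implyP[Ix1 /eqP x10]].
pose P n := `[< exists x, [/\ I x, x != 0 & `|v y x|%N = n] >].
have exP : exists n, P n by exists `|v y x1|%N; apply/asboolP; exists x1.
have [n /asboolP[x [Ix x0 vx]] nmin] := ex_minnP exP.
have Vx := IV _ Ix; exists x; split=> //; rewrite principal_ideal //.
apply/seteqP; split=> [z Iz|_ [r Vr <-]]; last exact: IM.
exists (z / x); last by rewrite divfK.
move=> _ -> zx0; move: (zx0); rewrite mulf_eq0 invr_eq0 negb_or => /andP[z0 _].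
rewrite vM ?invr_eq0 // vV //.
have : P `|v y z|%N by apply/asboolP; exists z.
move=> /nmin; have := IV _ Iz y erefl z0; have := Vx y erefl x0; lia.
Qed.

Lemma vring1_dvr y :
    (forall a, G a -> a y = 0 ->
      exists2 b, G b & [/\ forall z, 0 <= b z, b y = 1
                         & forall z, a z <> 0 -> b z = 0]) ->
  dvr (vring [set y]).
Proof.
move=> mask; have Mmax := @vmax_maximal [set y] y erefl mask.
split; [exact: vring_subring| |exact: vring1_ideal|].
  exists (vmax [set y] y); split=> // M [idM MnR Mm].
  have [MR _ _ MM] := idM.
  have [MJ _ _] := Mmax.
  have [//|//|E] := Mm _ MJ; last by case: Mmax => _ /(_ E).
  move=> f Mf; split=> [|f0]; first exact: MR.
  rewrite leNgt; apply/negP => f1; apply: MnR; apply: ideal1 => //.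
  rewrite -(mulVf f0); apply: MM => // _ -> _; rewrite vV //; lia.
have [b Gb [b0 by1 _]] := mask _ (fl0 G) erefl.
have [x x0 xb] := v_surj Gb; exists x; split=> // [_ -> _|/(_ y erefl)].
  by rewrite xb b0.
by rewrite /vge/= invr_eq0 => /(_ x0); rewrite vV // xb by1.
Qed.

Lemma loc_meet_vring C C' : C' `<=` C ->
  loc_meet (vring C) (vmax C @` C') = vring C'.
Proof.
move=> C'C; apply/seteqP; split=> f.
  move=> h y C'y; have := h (vmax C y) (imageP _ C'y).
  by rewrite loc_vmax; [move=> /(_ y erefl)|exact: C'C].
move=> C'f _ [y C'y <-]; rewrite loc_vmax; last exact: C'C.
by move=> _ ->; exact: C'f.
Qed.

Lemma vmax_extension C C' y : C' `<=` C -> C' y ->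
  ideal_gen (vring C') (vmax C y) = vmax C' y.
Proof.
move=> C'C C'y; have Cy := C'C _ C'y; apply/seteqP; split.
  apply: ideal_gen_sub; first exact: vmax_ideal.
  by move=> f [Cf fy]; split=> //; exact: vring_sub Cf.
move=> f [C'f fy]; have [->|f0] := eqVneq f 0.
  apply: ideal_gen_subset; have [_ ? _ _] := vmax_ideal Cy; done.
have [s [s0 vs vfs]] := exists_denominator f0.
have Mfs : vmax C y (f * s).
  split=> [z _ _|_]; rewrite vfs ?pospart_ge0 //.
  by rewrite /pospart; have := fy f0; lia.
have [|_ _ _ IM] := @ideal_gen_ideal K (vring C') (vring_subring C') (vmax C y).
  by move=> g [Cg _]; exact: vring_sub Cg.
rewrite -[f](mulfK s0) mulrC; apply: IM; last exact: ideal_gen_subset.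
move=> z C'z _; rewrite vV // vs /negpart; have := C'f z C'z f0; lia.
Qed.

(** The element with divisor e lies in the center of y and becomes a unit in
the larger ring. *)
Lemma vmax_extension_full C C' y e : C' `<=` C -> G e ->
    (forall z, C z -> 0 <= e z) -> 1 <= e y -> (forall z, C' z -> e z = 0) ->
  ideal_gen (vring C') (vmax C y) = vring C'.
Proof.
move=> C'C Ge e0 ey eC'; have [f f0 fe] := v_surj Ge.
have MR : vmax C y `<=` vring C' by move=> g [Cg _]; exact: vring_sub Cg.
have idI := ideal_gen_ideal (vring_subring C') MR.
apply: ideal1 => //; have [_ _ _ IM] := idI.
rewrite -(mulVf f0); apply: IM.
  by move=> z C'z _; rewrite vV // fe eC'.
by apply: ideal_gen_subset; split=> [z Cz _|_]; rewrite fe // e0.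
Qed.

Lemma vmax_inj_sep C y z e : G e -> (forall t, C t -> 0 <= e t) ->
  1 <= e y -> e z = 0 -> vmax C y <> vmax C z.
Proof.
move=> Ge e0 ey ez E; have [f f0 fe] := v_surj Ge.
have : vmax C y f by split=> [t Ct _|_]; rewrite fe // e0.
by rewrite E => -[_ /(_ f0)]; rewrite fe ez.
Qed.

Section Maximal.
Variable C : set X.
Hypothesis MaxC : Max (vring C) = vmax C @` C.

Lemma vring_almost_dedekind :
    (forall y a, C y -> G a -> a y = 0 ->
      exists2 b, G b & [/\ forall z, 0 <= b z, b y = 1
                         & forall z, a z <> 0 -> b z = 0]) ->
  almost_dedekind (vring C).
Proof.
move=> mask; split; first exact: vring_quotient_field.
rewrite MaxC => _ [y Cy <-]; rewrite loc_vmax //; apply: vring1_dvr => a.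
exact: mask.
Qed.

(** The minimum g of the divisors of the generators of I and of a function with
value 1 at y is an element of G below all elements of I.  If g z >= 2, an
element f of I is the product of an element p with divisor min (v f) e, where
e z = 1, and of f / p, and both lie in the center of z. *)
Lemma vmax_critical y : C y ->
    (forall g, G g -> (forall z, C z -> 0 <= g z) -> 1 <= g y ->
      exists2 z, C z & 2 <= g z) ->
    (forall z, C z -> exists2 e, G e & (forall t, C t -> 0 <= e t) /\ e z = 1) ->
  Crit (vring C) (vmax C y).
Proof.
move=> Cy crit unif; split; first by rewrite MaxC; exists y.
move=> I [Y [finY YR ->]] IM.
have YM : Y `<=` vmax C y by move=> f Yf; apply: IM; exact: ideal_gen_subset.
have [g [Gg g0 gy gY]] : exists g, [/\ G g, forall z, C z -> 0 <= g z, 1 <= g y &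
    forall f, Y f -> forall z, C z -> vge z (g z) f].
  move: finY YM => /finite_seqP[s ->]; elim: s => [|f s IH] sM.
    have [e Ge [e0 ey]] := unif _ Cy; exists e; split=> //; first by rewrite ey.
  have [|g [Gg g0 gy gs]] := IH.
    by move=> h /= hs; apply: sM => /=; rewrite inE hs orbT.
  have [->|f0] := eqVneq f 0.
    exists g; split=> // h /=; rewrite inE => /orP[/eqP -> z _|]; last exact: gs.
    exact: vge0.
  have [Cf fy] : vmax C y f by apply: sM; rewrite /= inE eqxx.
  exists (fun z => Num.min (v z f) (g z)); split.
  - exact: flmin (vG f0) Gg.
  - by move=> z Cz; rewrite le_min g0 // andbT; exact: Cf.
  - by rewrite le_min gy andbT; exact: fy.
  - move=> h /=; rewrite inE => /orP[/eqP -> z Cz _|hs z Cz].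
      by rewrite ge_min lexx.
    by apply: vgeW (gs h hs z Cz); rewrite ge_min lexx orbT.
have [z Cz gz] := crit g Gg g0 gy.
exists (vmax C z); split; first by rewrite MaxC; exists z.
have MMR : [set x | exists a b, [/\ vmax C z a, vmax C z b & x = a * b]]
    `<=` vring C.
  have [_ _ _ _ RM] := vring_prop C.
  by move=> _ [a [b [[Ca _] [Cb _] ->]]]; exact: RM.
apply: ideal_gen_sub; first exact: (ideal_gen_ideal (vring_subring C) MMR).
move=> f Yf; have [f0|f0] := eqVneq f 0.
  by have [_ I0 _ _] := ideal_gen_ideal (vring_subring C) MMR; rewrite f0.
apply: ideal_gen_subset.
have [e Ge [e0 ez]] := unif _ Cz.
have [p p0 pE] := v_surj (flmin (vG f0) Ge).
have fz : 2 <= v z f by apply: le_trans gz (gY f Yf z Cz f0).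
have Cf t : C t -> 0 <= v t f by move=> Ct; apply: YR.
exists p, (f / p); split; last by rewrite mulrC divfK.
  split=> [t Ct _|_]; rewrite pE; last by lia.
  by rewrite le_min e0 // Cf.
by split=> [t Ct|] _; rewrite vM ?invr_eq0 // vV // pE; lia.
Qed.

(** The ideal generated by an element with divisor e is contained in the square
of no center. *)
Lemma vmax_not_critical y e : G e -> (forall z, C z -> 0 <= e z) -> 1 <= e y ->
  (forall z, C z -> e z <= 1) -> C y -> ~ Crit (vring C) (vmax C y).
Proof.
move=> Ge e0 ey e1 Cy [_ crit]; have [f f0 fe] := v_surj Ge.
have Cf : vring C f by move=> z Cz _; rewrite fe e0.
have [||N []] := crit (ideal_gen (vring C) [set f]).
- by exists [set f]; split=> // _ ->.
- apply: ideal_gen_sub; first exact: vmax_ideal.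
  by move=> _ ->; split=> // _; rewrite fe.
rewrite MaxC => -[z Cz <-] fNN.
have NN2 : ideal_mul (vring C) (vmax C z) (vmax C z) `<=` vring C `&` vge z 2.
  apply: ideal_gen_sub; first exact: vge_ideal.
  have [_ _ _ _ RM] := vring_prop C.
  move=> _ [a [b [[Ca az] [Cb bz] ->]]]; split; first exact: RM.
  exact: vgeM az bz.
have /NN2[_ /(_ f0)] := fNN f (@ideal_gen_subset _ _ _ _ erefl).
by rewrite fe; have := e1 z Cz; lia.
Qed.

End Maximal.

End ValuedField.


(** * The group of almost doubling functions on a tree *)

Lemma suffix_consE (T : eqType) (s t : seq T) x :
  suffix s (x :: t) = (s == x :: t) || suffix s t.
Proof.
apply/idP/orP => [/suffixP[[|y u]]|[/eqP ->|/suffixP[u ->]]].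
- by move=> /= ->; left.
- by move=> /= [_ ->]; right; exact: suffix_suffix.
- exact: suffix_refl.
- by apply/suffixP; exists (x :: u).
Qed.

Lemma suffix_anti (T : eqType) (s t : seq T) : suffix s t -> suffix t s -> s = t.
Proof.
move=> /suffixP[u ->] /size_suffix; rewrite size_cat.
by case: u => //= x u; rewrite addSn ltnNge leq_addl.
Qed.

Section Tree.
Variables (d : Order.disp_t) (A : orderType d) (alpha : A).

(** The parent of a node is its behead and the subtree below y consists of the
sequences having y as a suffix.  The empty sequence is an auxiliary root, at
which all functions vanish; its rank alpha bounds the ranks of its children. *)
Definition node := seq (A * nat).
HB.instance Definition _ := Choice.on node.
HB.instance Definition _ := isPointed.Build node [::].

Implicit Types (x y z : node) (a b : node -> int).

Definition rank x : A := if x is h :: _ then h.1 else alpha.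

Fixpoint valid x : bool :=
  if x is h :: t then (h.1 < rank t)%O && valid t else true.

Definition exceptions a : set node := [set x | a x <> a (behead x) *+ 2].

Definition doubling a : Prop := a [::] = 0 /\ finite_set (exceptions a).

Fact doubling0 : doubling (fun=> 0).
Proof.
split=> //; apply: sub_finite_set (@finite_set0 _) => x.
by rewrite /exceptions/= mul0rn.
Qed.

Fact doublingB a b : doubling a -> doubling b -> doubling (fun x => a x - b x).
Proof.
move=> [a0 fa] [b0 fb]; split; first by rewrite a0 b0.
apply: (@sub_finite_set _ _ (exceptions a `|` exceptions b)).
  move=> x; rewrite /exceptions/=; apply: contra_notP => /not_orP[].
  by move=> /contrapT -> /contrapT ->; rewrite mulrnBl.
by rewrite finite_setU.
Qed.

Fact doubling_min a b : doubling a -> doubling b ->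
  doubling (fun x => Num.min (a x) (b x)).
Proof.
move=> [a0 fa] [b0 fb]; split; first by rewrite a0 b0.
apply: (@sub_finite_set _ _ (exceptions a `|` exceptions b)).
  move=> x; rewrite /exceptions/=; apply: contra_notP => /not_orP[].
  by move=> /contrapT -> /contrapT ->; lia.
by rewrite finite_setU.
Qed.

Definition tree_group : flgroup node := FLGroup doubling0 doublingB doubling_min.

Definition restrict y a x : int := if suffix y x then a x else 0.

Lemma suffix_behead y x : x <> y -> suffix y (behead x) = suffix y x.
Proof.
by case: x => //= h t /eqP /negPf hty; rewrite suffix_consE eq_sym hty.
Qed.

Lemma restrict_doubling y a : doubling a -> doubling (restrict y a).
Proof.
move=> [a0 fa]; split; first by rewrite /restrict a0 if_same.
apply: (@sub_finite_set _ _ (exceptions a `|` [set y])).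
  move=> x; rewrite /exceptions/= /restrict; apply: contra_notP => /not_orP[].
  by move=> /contrapT aE xy; rewrite suffix_behead // aE; case: ifP.
by rewrite finite_setU; split=> //; exact: finite_set1.
Qed.

(** The indicator of y extended by doubling to the part of the subtree below y
where a vanishes.  Outside the exceptions of a, a node is a zero of a if and
only if its parent is, so only finitely many new exceptions arise. *)
Definition spike y a x : int :=
  if (a x == 0) && suffix y x then 2 ^+ (size x - size y) else 0.

Lemma spike_doubling y a : y <> [::] -> doubling a -> doubling (spike y a).
Proof.
move=> y0 [a0 fa]; split.
  by rewrite /spike suffixs0; move/eqP/negPf: y0 => ->; rewrite andbF.
apply: (@sub_finite_set _ _ (exceptions a `|` [set y])); last first.
  by rewrite finite_setU; split=> //; exact: finite_set1.
move=> x; rewrite /exceptions/= /spike; apply: contra_notP => /not_orP[].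
move=> /contrapT aE xy; rewrite suffix_behead // aE mulrn_eq0 /=.
case: eqP => //= _; case: ifP => // yx.
case: x xy yx {aE} => [|h t] /= xy; first by rewrite suffixs0 => /eqP.
rewrite suffix_consE eq_sym => /orP[/eqP/xy//|/size_suffix yt].
by rewrite subSn // exprS mulr_natl.
Qed.

Lemma spike_ge0 y a x : 0 <= spike y a x.
Proof. by rewrite /spike; case: ifP => // _; exact: exprn_ge0. Qed.

Lemma spike_top y a : a y = 0 -> spike y a y = 1.
Proof. by move=> ay; rewrite /spike ay eqxx suffix_refl subnn. Qed.

Lemma spike_out y a x : ~~ suffix y x -> spike y a x = 0.
Proof. by rewrite /spike => /negPf ->; rewrite andbF. Qed.

Lemma spike_mask y a : y <> [::] -> doubling a -> a y = 0 ->
  exists2 b, doubling b & [/\ forall z, 0 <= b z, b y = 1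
                            & forall z, a z <> 0 -> b z = 0].
Proof.
move=> y0 Ga ay; exists (spike y a); first exact: spike_doubling.
split=> [z||z az]; [exact: spike_ge0|exact: spike_top|].
by rewrite /spike; case: eqP.
Qed.

(** A function vanishing at y can become nonzero below y only at an
exception. *)
Lemma exception_on_path a y x : a y = 0 -> suffix y x -> a x <> 0 ->
  exists z, [/\ suffix y z, suffix z x, z <> y & exceptions a z].
Proof.
move=> ay; elim: x => [|h t IH].
  by rewrite suffixs0 => /eqP yE; rewrite -yE.
rewrite suffix_consE => /orP[/eqP <-//|yt] ax.
have [at0|at0] := pselect (a t = 0).
  exists (h :: t); rewrite suffix_refl suffix_consE yt orbT; split=> //.
    move=> hty; move: yt; rewrite -hty => /size_suffix /=.
    by rewrite ltnn.
  by rewrite /exceptions/= at0 mul0rn.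
have [z [yz zt zy ez]] := IH yt at0.
by exists z; split=> //; rewrite suffix_consE zt orbT.
Qed.

Lemma valid_rank_lt x : x <> [::] -> valid x -> (rank x < alpha)%O.
Proof.
elim: x => // h [|h' t] IH _ /= /andP[hr vt] //.
by apply: lt_trans hr (IH _ vt).
Qed.

Lemma suffix_rank y x : valid x -> suffix y x -> x <> y -> (rank x < rank y)%O.
Proof.
elim: x => [|h t IH]; first by rewrite suffixs0 => _ /eqP ->.
move=> /= /andP[hr vt]; rewrite suffix_consE => /orP[/eqP ->//|yt] _.
by have [<-//|ty] := eqVneq t y; apply: lt_trans hr (IH vt yt _); apply/eqP.
Qed.

(** Each label occurs on infinitely many children of y. *)
Lemma child_not_exception a y (c : A) : finite_set (exceptions a) ->
  exists n, a ((c, n) :: y) = a y *+ 2.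
Proof.
move=> fa; apply: contrapT => noex; apply: infinite_nat.
have : finite_set (exceptions a `&` [set (c, n) :: y | n in [set: nat]]).
  exact: finite_setIl.
move=> /(@finite_image _ nat _ (fun x => (head (c, 0) x).2)).
apply: sub_finite_set => n _; exists ((c, n) :: y) => //.
by split; [move=> e; apply: noex; exists n|exists n].
Qed.

(** * Maximal ideals are centers of points *)

Section MaxTree.
Variables (K : fieldType) (v : node -> K -> int).
Hypothesis vM : forall x f g, f != 0 -> g != 0 -> v x (f * g) = v x f + v x g.
Hypothesis vD : forall x f g, f != 0 -> g != 0 -> f + g != 0 ->
  Num.min (v x f) (v x g) <= v x (f + g).
Hypothesis vG : forall f, f != 0 -> doubling (v^~ f).
Hypothesis vmin : forall a b, doubling a -> doubling b -> a <> b ->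
  exists f g, [/\ [/\ f != 0, g != 0 & f + g != 0], v^~ f = a, v^~ g = b
    & forall x, v x (f + g) = Num.min (a x) (b x)].
Hypothesis wf : well_founded (fun b a : A => (b < a)%O).

Let vsurj := @v_surj K node v tree_group vM vmin.
Let vbezout := @v_bezout K node v tree_group vM vG vmin.
Let subR := vring_subring vM vD.

Variable C : set node.
Hypothesis Cvalid : forall x, C x -> valid x.
Hypothesis C0 : ~ C [::].
Hypothesis Cup : forall x y, C x -> suffix y x -> y <> [::] -> C y.

Lemma prod_neq0 (F : node -> K) (s : seq node) :
  (forall x, F x != 0) -> \prod_(x <- s) F x != 0.
Proof. by move=> F0; rewrite prodf_seq_neq0; apply/allP => x _; rewrite F0. Qed.

Lemma v_prod (F : node -> K) (s : seq node) z :
  (forall x, F x != 0) -> v z (\prod_(x <- s) F x) = \sum_(x <- s) v z (F x).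
Proof.
move=> F0; elim: s => [|x s IH]; first by rewrite !big_nil (v1 vM).
by rewrite !big_cons vM ?IH // prod_neq0.
Qed.

Lemma maximal_prod (M : set K) (F : node -> K) (s : seq node) :
  is_maximal (vring v C) M -> (forall x, vring v C (F x)) ->
  M (\prod_(x <- s) F x) -> exists2 x, x \in s & M (F x).
Proof.
move=> mM CF; have [_ R1 _ _ RM] := vring_prop vM vD C.
have [idM MnR _] := mM.
have CP (t : seq node) : vring v C (\prod_(x <- t) F x).
  by elim: t => [|x t IH]; rewrite ?big_nil ?big_cons //; exact: RM.
elim: s => [|x s IH]; first by rewrite big_nil => /(ideal1 idM)/MnR.
rewrite big_cons => /(maximal_prime (subR C) mM (CF x) (CP s))[Mx|/IH[z zs Mz]].
  by exists x; rewrite ?inE ?eqxx.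
by exists z; rewrite ?inE ?zs ?orbT.
Qed.

(** Descent along the tree, by induction on the rank of y.  The hypothesis on f
says that f is a unit at the points outside the subtree below y; it holds
trivially for the auxiliary root. *)
Lemma maximal_sub_vmax (M : set K) : is_maximal (vring v C) M ->
  forall y f, y = [::] \/ C y -> M f -> f != 0 ->
    (forall z, C z -> ~~ suffix y z -> v z f = 0) ->
  exists2 z, C z & M `<=` vmax v C z.
Proof.
move=> mM y; have [[MR _ MD MM] MnR _] := mM.
have idM : is_ideal (vring v C) M by case: mM.
have unitM f : M f -> f != 0 -> (forall z, C z -> v z f = 0) -> False.
  move=> Mf f0 vf; apply: MnR; apply: ideal1 => //.
  by rewrite -(mulVf f0); apply: MM => // z Cz _; rewrite (vV vM) // vf.
have [c cE] : exists c, c = rank y by exists (rank y).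
elim/(well_founded_ind wf): c y cE => c IH y cE f yC Mf f0 fy.
have [[Cy My]|nMy] := pselect (C y /\ M `<=` vmax v C y); first by exists y.
(* Some h in M has value 0 at y; a greatest common divisor of f and h is
   then a unit at y as well. *)
have [g [Mg g0 gy vgy]] : exists g, [/\ M g, g != 0,
    forall z, C z -> ~~ suffix y z -> v z g = 0 & v y g = 0].
  case: yC => [yE|Cy].
    by exists f; split=> //; rewrite yE; case: (vG f0).
  have /existsNP[h /not_implyP[Mh nMh]] : ~ M `<=` vmax v C y.
    by move=> My; exact: nMy.
  have Ch := MR _ Mh.
  have h0 : h != 0.
    by apply/eqP => hE; apply: nMh; rewrite hE; have [] := vmax_ideal vM vD Cy.
  have vyh : v y h = 0.
    apply/eqP; rewrite eq_le (Ch y Cy h0) andbT leNgt; apply/negP => hy.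
    by apply: nMh; split=> // _; lia.
  have [r [s [r0 s0 e0 ve]]] := vbezout f0 h0.
  exists (r * f + s * h); split=> //.
  - by apply: MD; apply: MM => // z _; [exact: r0|exact: s0].
  - by move=> z Cz yz; rewrite ve fy // min_l //; exact: Ch.
  - by rewrite ve vyh min_r //; exact: MR.
have [_ /finite_seqP[s sE]] := vG g0.
have Cg z : C z -> 0 <= v z g by move=> Cz; exact: MR.
have /choice[F FP] : forall x, exists h,
    h != 0 /\ forall z, v z h = restrict x (v^~ g) z.
  by move=> x; have [h h0 hE] := vsurj (restrict_doubling x (vG g0)); exists h.
have CF x : vring v C (F x).
  by move=> z Cz _; rewrite (FP x).2 /restrict; case: ifP => // _; exact: Cg.
pose t := [seq x <- s | `[< [/\ C x, suffix y x & x <> y] >]].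
(* Any nonzero value of g at z is counted at least once in the product, by
   the exception on the path from y to z, so that g divides the product. *)
have Mprod : M (\prod_(x <- t) F x).
  rewrite -[X in M X](divfK g0); apply: MM => // z Cz prod0.
  have F0 x : F x != 0 by case: (FP x).
  have P0 : \prod_(x <- t) F x != 0 by exact: prod_neq0.
  rewrite vM ?invr_eq0 // (vV vM) // subr_ge0 v_prod //.
  have sum_ge0 (u : seq node) : 0 <= \sum_(x <- u) v z (F x).
    by apply: sumr_ge0 => x _; apply: (CF x z Cz); exact: F0.
  have [->|/eqP zg] := eqVneq (v z g) 0; first exact: sum_ge0.
  have yz : suffix y z by apply/negPn/negP => /(gy z Cz).
  have [x [yx xz xy ex]] := @exception_on_path (v^~ g) y z vgy yz zg.
  have x0 : x <> [::].
    by move=> xE; move: yx; rewrite xE suffixs0 => /eqP yE; case: xy; rewrite xE yE.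
  have xt : x \in t.
    rewrite mem_filter; apply/andP; split.
      by apply/asboolP; split=> //; exact: Cup xz x0.
    by have : [set` s] x by rewrite -sE.
  rewrite (perm_big _ (perm_to_rem xt)) big_cons.
  by rewrite (FP x).2 /restrict xz lerDl sum_ge0.
have [x] := maximal_prod mM CF Mprod.
rewrite mem_filter => /andP[/asboolP[Cx yx xy] _] MFx.
apply: (IH (rank x) _ x erefl (F x)) => //.
- by rewrite cE; apply: suffix_rank => //; exact: Cvalid.
- by right.
- by case: (FP x).
- by move=> z Cz /negPf xz; rewrite (FP x).2 /restrict xz.
Qed.

Lemma Max_vring : C !=set0 -> Max (vring v C) = vmax v C @` C.
Proof.
move=> [y0 Cy0]; have Cneq0 y : C y -> y <> [::].
  by move=> Cy yE; apply: C0; rewrite -yE.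
have maxC y : C y -> is_maximal (vring v C) (vmax v C y).
  move=> Cy; apply: (@vmax_maximal K node v tree_group) => // a.
  by apply: spike_mask; exact: Cneq0.
apply/seteqP; split=> [M mM|_ [y Cy <-]]; last exact: maxC.
have [[MR M0 _ _] MnR Mmax] := mM.
have [z Cz Mz] : exists2 z, C z & M `<=` vmax v C z.
  have [M00|/existsNP[f /not_implyP[Mf /eqP f0]]] :=
    pselect (forall f, M f -> f = 0).
    by exists y0 => // f /M00 ->; have [] := vmax_ideal vM vD Cy0.
  apply: (maximal_sub_vmax mM (or_introl erefl) Mf f0) => z _.
  by rewrite suffix0s.
exists z => //; have [idz znR _] := maxC z Cz.
by have [->|/znR] := Mmax _ idz Mz.
Qed.

End MaxTree.
End Tree.


(** * The critical points of the tree *)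

Section Hierarchy.
Variables (d : Order.disp_t) (A : orderType d).
Hypothesis wf : well_founded (fun b a : A => (b < a)%O).
Variable alpha : A.
Hypothesis alpha_neq0 : ~ is_zero alpha.

Notation node := (node A).
Notation rank := (rank alpha).
Notation valid := (valid alpha).
Implicit Types (b c : A) (x y z : node).

Variables (K : fieldType) (v : node -> K -> int).
Hypothesis vM : forall x f g, f != 0 -> g != 0 -> v x (f * g) = v x f + v x g.
Hypothesis vD : forall x f g, f != 0 -> g != 0 -> f + g != 0 ->
  Num.min (v x f) (v x g) <= v x (f + g).
Hypothesis vG : forall f, f != 0 -> doubling (v^~ f).
Hypothesis vmin : forall a b : node -> int, doubling a -> doubling b -> a <> b ->
  exists f g, [/\ [/\ f != 0, g != 0 & f + g != 0], v^~ f = a, v^~ g = b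
    & forall x, v x (f + g) = Num.min (a x) (b x)].

Let G := tree_group A.

Definition nodes : set node := [set x | valid x /\ x <> [::]].

Definition nodes_ge b : set node := nodes `&` [set x | (b <= rank x)%O].

Lemma nodes_ge_sub b : nodes_ge b `<=` nodes. Proof. by move=> x []. Qed.

Lemma nodes_ge_zero b : is_zero b -> nodes_ge b = nodes.
Proof.
by move=> b0; apply/seteqP; split=> x => [[]|nx] //; split=> //; exact: b0.
Qed.

Lemma nodes_ge_top : nodes_ge alpha = set0.
Proof.
apply/seteqP; split=> // x [[vx x0]] /=.
by rewrite leNgt (valid_rank_lt x0).
Qed.

Lemma nodes_ge_neq0 b : (b < alpha)%O -> nodes_ge b !=set0.
Proof.
move=> ba; exists [:: (b, 0%N)]; split=> /=; last exact: lexx.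
by split=> //=; rewrite ba.
Qed.

Lemma suffix_nodes_ge b x y : nodes_ge b x -> suffix y x -> y <> [::] ->
  nodes_ge b y.
Proof.
move=> [[vx x0] bx] yx y0; have [<-//|/eqP xy] := eqVneq x y.
split; last by apply: (le_trans bx); apply/ltW/suffix_rank.
split=> //; elim: x vx yx {x0 bx xy} => [|h t IH] /=.
  by rewrite suffixs0 => _ /eqP ->.
move=> /andP[hr vt]; rewrite suffix_consE => /orP[/eqP ->|]; last exact: IH.
by rewrite /= hr.
Qed.

Lemma Max_nodes_ge b : (b < alpha)%O ->
  Max (vring v (nodes_ge b)) = vmax v (nodes_ge b) @` nodes_ge b.
Proof.
move=> ba; apply: (Max_vring (alpha := alpha) vM vD vG vmin wf).
- move=> x [[vx _] _]. exact: vx.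
- by move=> [[_ x0] _]; exact: x0.
- by move=> x y; exact: suffix_nodes_ge.
- exact: nodes_ge_neq0.
Qed.

Lemma spike_unit y : y <> [::] ->
  doubling (spike y (fun=> 0)) /\ spike y (fun=> 0) y = 1.
Proof.
move=> y0; split; last exact: spike_top.
by apply: spike_doubling => //; exact: fl0 G.
Qed.

(** In the set of nodes of rank >= b, a node of rank b has nothing below it, so
spike y 0 is its indicator; a node of larger rank has a child of rank b where
the value of a given g doubles. *)
Lemma Crit_nodes_ge b y : (b < alpha)%O -> nodes_ge b y ->
  Crit (vring v (nodes_ge b)) (vmax v (nodes_ge b) y) <-> (b < rank y)%O.
Proof.
move=> ba by_; have [[vy y0] by'] := by_; have MaxC := Max_nodes_ge ba.
have [Gy yy] := spike_unit y0.
split=> [crit|ry].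
  rewrite lt_neqAle by' andbT; apply/eqP => bE.
  apply: (@vmax_not_critical K node v G vM vD vmin _ MaxC _ _ Gy _ _ _ by_ crit).
  - by move=> z _; exact: spike_ge0.
  - by rewrite yy.
  - move=> z [[vz z0] bz].
    have [->|/eqP zy] := eqVneq z y; first by rewrite yy.
    rewrite spike_out //; apply/negP => /(suffix_rank vz)/(_ zy).
    by rewrite -bE ltNge bz.
apply: (@vmax_critical K node v G vM vD vG vmin _ MaxC) => //.
  move=> g [_ fg] _ gy; have [n gn] := child_not_exception y b fg.
  exists ((b, n) :: y); last by rewrite gn; lia.
  by split; [split=> //=; rewrite ry vy|exact: lexx].
move=> z [[vz z0] _]; have [Gz zz] := spike_unit z0.
by exists (spike z (fun=> 0)) => //; split=> // t _; exact: spike_ge0.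
Qed.

Notation D := (vring v nodes).

(** Of two distinct nodes at least one is not below the other. *)
Lemma vmax_nodes_inj y z : nodes y -> nodes z ->
  vmax v nodes y = vmax v nodes z -> y = z.
Proof.
have sep x t : nodes x -> ~~ suffix x t -> vmax v nodes x <> vmax v nodes t.
  move=> [_ x0] xt; have [Gx xx] := spike_unit x0.
  apply: (@vmax_inj_sep K node v G vM vmin nodes _ _ _ Gx).
  - by move=> s _; exact: spike_ge0.
  - by rewrite xx.
  - exact: spike_out.
move=> ny nz yz; apply: suffix_anti; apply/negPn/negP => h.
  exact: sep h yz.
exact: sep h (esym yz).
Qed.

Lemma D_zero b : is_zero b -> D = vring v (nodes_ge b).
Proof. by move=> /nodes_ge_zero ->. Qed.

Lemma zero_lt_alpha b : is_zero b -> (b < alpha)%O.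
Proof.
move=> b0; rewrite lt_neqAle b0 andbT; apply/eqP => bE.
by apply: alpha_neq0; rewrite -bE.
Qed.

Lemma Max_D : Max D = vmax v nodes @` nodes.
Proof.
have [z z0] : exists z : A, is_zero z.
  elim/(well_founded_ind wf): alpha => b IH.
  have [b0|/existsNP[c /negP]] := pselect (is_zero b); first by exists b.
  by rewrite -ltNge => /IH.
by rewrite -(nodes_ge_zero z0); exact/Max_nodes_ge/zero_lt_alpha.
Qed.

Lemma almost_dedekind_D : almost_dedekind D.
Proof.
apply: (vring_almost_dedekind (G := G) vM vD vG vmin Max_D) => y a [_ y0].
exact: spike_mask.
Qed.

(** At a successor of c, the ring of the previous stage is the ring of elements
integral on the nodes of rank >= c, to which Crit_nodes_ge applies; the centers
of the nodes of smaller rank extend to the whole ring.  At a limit, a node in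
all previous stages has a rank bounded below by all smaller ordinals, where
injectivity of node to center allows one and the same node to be used. *)
Lemma Crit_iter_nodes b : (b <= alpha)%O ->
  Crit_iter wf D b = vmax v nodes @` nodes_ge b.
Proof.
elim/(well_founded_ind wf): b => b IH ba.
have [b0|b_neq0] := pselect (is_zero b).
  by rewrite Crit_zero // (nodes_ge_zero b0) Max_D.
have [[c cb]|nsucc] := pselect (exists c, succ_of c b); last first.
  rewrite Crit_limit //; apply/seteqP; split=> [P PC|_ [y by_ <-] c cb] /=.
    have [c cb] : exists c, (c < b)%O.
      apply: contrapT => nb; apply: b_neq0 => c; rewrite leNgt; apply/negP => cb.
      by apply: nb; exists c.
    have PE e : (e < b)%O -> (vmax v nodes @` nodes_ge e) P.
      by move=> eb; rewrite -IH //; [exact: PC|exact: ltW (lt_le_trans eb ba)].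
    have [y [ny cy] yP] := PE c cb; exists y => //; split=> //=.
    rewrite leNgt; apply/negP => ryb; apply: nsucc; exists (rank y).
    split=> // e eb; have [z [nz ez] zP] := PE e eb.
    by rewrite (vmax_nodes_inj ny nz) // yP.
  rewrite IH //; last exact: ltW (lt_le_trans cb ba).
  exists y => //; case: by_ => ny by_; split=> //=.
  exact: le_trans (ltW cb) by_.
have cb' := cb.1; have ca : (c < alpha)%O := lt_le_trans cb' ba.
have sub := @nodes_ge_sub c.
have TE : overring wf D c = vring v (nodes_ge c).
  have [c0|c_neq0] := pselect (is_zero c).
    by rewrite overring_zero // (D_zero c0).
  rewrite overring_pos // IH ?(ltW ca) //.
  by apply: (loc_meet_vring (G := G) vM vD vG vmin).
rewrite (Crit_succ wf D cb) TE; apply/seteqP; split=> P /=.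
  rewrite Max_D => -[[y ny <-]]; have [cy|cy] := leP c (rank y).
    have cny : nodes_ge c y by split.
    rewrite (vmax_extension (G := G) vM vD vG vmin sub) //.
    move=> /(Crit_nodes_ge ca cny) cry.
    exists y => //; split=> //=; rewrite leNgt; apply/negP => /cb.2.
    by rewrite leNgt cry.
  have [_ y0] := ny; have [Gy yy] := spike_unit y0.
  rewrite (vmax_extension_full (G := G) vM vD vmin sub Gy).
  - by move=> [[_ /(_ erefl)]].
  - by move=> z _; exact: spike_ge0.
  - by rewrite yy.
  - move=> z [[vz z0] /= cz]; apply: spike_out; apply/negP => yz.
    have [zy|/eqP zy] := eqVneq z y; first by move: cz; rewrite zy leNgt cy.
    by have := lt_trans (suffix_rank vz yz zy) cy; rewrite ltNge cz.
move=> [y [ny by_] <-]; split; first by rewrite Max_D; exists y.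
have cry : (c < rank y)%O := lt_le_trans cb' by_.
have cny : nodes_ge c y by split=> //; exact: ltW.
by rewrite (vmax_extension (G := G) vM vD vG vmin sub) //; exact/Crit_nodes_ge.
Qed.

Lemma SP_rank_D : is_SP_rank wf D alpha.
Proof.
split=> [|b Cb]; first by rewrite Crit_iter_nodes // nodes_ge_top image_set0.
rewrite leNgt; apply/negP => ba; have [x bx] := nodes_ge_neq0 ba.
have : Crit_iter wf D b (vmax v nodes x).
  by rewrite Crit_iter_nodes ?(ltW ba) //; exists x.
by rewrite Cb.
Qed.

End Hierarchy.

Theorem corollary5p5 (d : Order.disp_t) (A : orderType d)
    (wf : well_founded (fun b a : A => (b < a)%O))
    (alpha : A) (alpha_neq0 : ~ is_zero alpha) :
  exists (K : fieldType) (D : set K),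
    almost_dedekind D /\ is_SP_rank wf D alpha.
Proof.
have [K [v [vM vD vG vmin]]] := realize_flgroup (tree_group A).
exists K, (vring v (nodes alpha)); split.
- exact: (almost_dedekind_D wf).
- exact: SP_rank_D.
Qed.
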